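(* Let $B$ be a finite connected left regular band and $\Bbbk$ a field. Then the quiver of $\Bbbk B$ has vertex set $\Lambda(B)$. There are no arrows $X\to Y$ unless $X<Y$, in which case the number of arrows $X\to Y$ is one fewer than the number of connected components of $\Delta(\partial e_YB_{\ge X})$, where $e_Y\in B$ satisfies $Be_Y=Y$.
   Context: A left regular band is a finite semigroup $B$ with $x^2=x$, $xyx=xy$, ordered by $a\le b$ iff $ba=a$; $\Lambda(B)=\{Bb\}$ ordered by inclusion; $B_{\ge X}=\{b\mid Bb\supseteq X\}$; $\Delta(\cdot)$ is the order complex; $B$ is connected if each $\Delta(B_{\ge X})$ is connected (then $\Bbbk B$ is a unital split basic algebra). The simple $\Bbbk B$-modules are $\Bbbk_X$, $X\in\Lambda(B)$ ($b$ acts by $1$ if $Bb\supseteq X$, else $0$), and we identify $\Bbbk_X$ with $X$. The (Gabriel) quiver of $\Bbbk B$ has the simple modules as vertices and $\dim_\Bbbk\mathrm{Ext}^1_{\Bbbk B}(S,S')$ arrows $S\to S'$. $\partial e_YB_{\ge X}=e_YB_{\ge X}\setminus\{e_Y\}$. *)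

(* Defs.v *)
From HB Require Import structures.
From mathcomp Require Import all_boot all_order all_algebra.
From mathcomp Require Import monoid finmap.
From mathcomp.multinomials Require Import monalg.

Set Implicit Arguments.
Unset Strict Implicit.
Unset Printing Implicit Defensive.

Import GRing.Theory.
Local Open Scope ring_scope.

(* Semigroups are nonempty, as usual; this makes the algebra of a band a nonzero
   ring. *)
HB.mixin Record isLeftRegularBand B of Semigroup B & Finite B := {
  band_inhabited : exists b : B, true;
  bandxx : forall x : B, (x * x)%g = x;
  bandxyx : forall x y : B, ((x * y) * x)%g = (x * y)%g
}.

#[short(type="lrbType")]
HB.structure Definition LeftRegularBand :=
  {B of isLeftRegularBand B & Semigroup B & Finite B}.

Section OrderComplex.
Variable T : finType.

(* Abstract simplicial complex of the nonempty finite chains of [P]. *)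
Definition order_complex (le : rel T) (P : {set T}) : {set {set T}} :=
  [set s : {set T} | [&& s != set0, s \subset P &
     [forall a in s, forall b in s, le a b || le b a]]].

(* The connected components of a simplicial complex are those of the graph
   formed by its vertices and edges; the empty complex has none. *)
Definition n_components (K : {set {set T}}) : nat :=
  n_comp [rel x y | [set x; y] \in K] [pred x | [set x] \in K].

End OrderComplex.

Section Band.
Variable B : lrbType.
Implicit Types a b c : B.

Definition band_le : rel B := fun a b => (b * a)%g == a.

Definition lideal b : {set B} := [set (a * b)%g | a : B].

Definition is_lideal (X : {set B}) : bool := [exists b, X == lideal b].

Record Lam : Type := MkLam { lam_set :> {set B}; lam_principal : is_lideal lam_set }.

HB.instance Definition _ := [isSub for lam_set].
HB.instance Definition _ := [Finite of Lam by <:].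

Definition upset (X : Lam) : {set B} := [set b | X \subset lideal b].

Lemma mem_lideal a b : (a \in lideal b) = ((a * b)%g == a).
Proof.
apply/imsetP/eqP => [[c _ ->]|<-]; last by exists a.
by rewrite -mulgA bandxx.
Qed.

Lemma lideal_sub a b : (lideal a \subset lideal b) = ((a * b)%g == a).
Proof.
apply/subsetP/eqP => [/(_ a)|ab c]; first by rewrite !mem_lideal bandxx eqxx => /(_ isT)/eqP.
by rewrite !mem_lideal => /eqP <-; rewrite -mulgA ab.
Qed.

End Band.

HB.mixin Record LRB_isConnected B of LeftRegularBand B := {
  lrb_connected : forall X : Lam B,
    n_components (order_complex (@band_le B) (upset X)) = 1%N
}.

#[short(type="clrbType")]
HB.structure Definition ConnectedLRB :=
  {B of LRB_isConnected B & LeftRegularBand B}.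

Section Convolution.
Variables (B : clrbType) (k : fieldType).
Implicit Types (a b c x : B) (f g h e : {ffun B -> k}) (D : B -> k).

Definition conv f g : {ffun B -> k} :=
  [ffun c => \sum_(p : B * B | (p.1 * p.2)%g == c) f p.1 * g p.2].

(* The basis element b, and the linear extension of D : B -> k to kB. *)
Definition pt b : {ffun B -> k} := [ffun c => (c == b)%:R].

Definition ev f D : k := \sum_b f b * D b.

Lemma eq_ev f D D' : D =1 D' -> ev f D = ev f D'.
Proof. by move=> eqD; apply: eq_bigr => b _; rewrite eqD. Qed.

Lemma ev_delta f c : ev f (fun b => (b == c)%:R) = f c.
Proof.
rewrite /ev (bigD1 c) //= eqxx mulr1 big1 ?addr0 // => b /negPf ->.
by rewrite mulr0.
Qed.

Lemma ev_inj f g : (forall D, ev f D = ev g D) -> f = g.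
Proof. by move=> fg; apply/ffunP => c; rewrite -!ev_delta. Qed.

Lemma evDl f g D : ev (f + g) D = ev f D + ev g D.
Proof. by rewrite -big_split; apply: eq_bigr => b _; rewrite ffunE mulrDl. Qed.

Lemma evNl f D : ev (- f) D = - ev f D.
Proof. by rewrite -sumrN; apply: eq_bigr => b _; rewrite ffunE mulNr. Qed.

Lemma evBr f D D' : ev f (fun b => D b - D' b) = ev f D - ev f D'.
Proof. by rewrite -sumrB; apply: eq_bigr => b _; rewrite mulrBr. Qed.

Lemma ev_pt b D : ev (pt b) D = D b.
Proof.
rewrite /ev (bigD1 b) //= ffunE eqxx mul1r big1 ?addr0 // => c /negPf cb.
by rewrite ffunE cb mul0r.
Qed.

Lemma ev_conv f g D : ev (conv f g) D = ev f (fun a => ev g (fun b => D (a * b)%g)).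
Proof.
transitivity (\sum_(p : B * B) f p.1 * g p.2 * D (p.1 * p.2)%g).
  rewrite (partition_big (fun p : B * B => (p.1 * p.2)%g) xpredT) //=.
  apply: eq_bigr => c _; rewrite ffunE mulr_suml.
  by apply: eq_bigr => p /eqP ->.
rewrite -(pair_bigA _ (fun a b => f a * g b * D (a * b)%g)) /=.
apply: eq_bigr => a _; rewrite mulr_sumr.
by apply: eq_bigr => b _; rewrite mulrA.
Qed.

Lemma ev_exchange f g (G : B -> B -> k) :
  ev f (fun a => ev g (G a)) = ev g (fun b => ev f (G^~ b)).
Proof.
rewrite /ev; under eq_bigr => a _ do rewrite mulr_sumr.
rewrite exchange_big; apply: eq_bigr => b _; rewrite mulr_sumr.
by apply: eq_bigr => a _; rewrite mulrCA.
Qed.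

Lemma convA : associative conv.
Proof.
move=> f g h; apply: ev_inj => D; rewrite !ev_conv; apply: eq_ev => a.
by rewrite ev_conv; apply: eq_ev => b; apply: eq_ev => c; rewrite mulgA.
Qed.

Lemma convDl : left_distributive conv +%R.
Proof. by move=> f g h; apply: ev_inj => D; rewrite ev_conv !evDl !ev_conv. Qed.

Lemma convDr : right_distributive conv +%R.
Proof.
move=> f g h; apply: ev_inj => D; rewrite evDl !ev_conv -big_split.
by apply: eq_bigr => a _; rewrite evDl mulrDr.
Qed.

Lemma bandxwx a b : (a * b * a = a * b)%g. Proof. exact: bandxyx. Qed.

(* A right identity always exists; it is built one principal left ideal at a
   time, by increasing size. *)
Lemma conv_right_id : exists e, forall a D, ev e (fun b => D (a * b)%g) = D a.
Proof.
pose ok e a := forall D, ev e (fun b => D (a * b)%g) = D a.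
have sizeM a b : (#|lideal (a * b)%g| <= #|lideal a|)%N.
  by apply/subset_leq_card; rewrite lideal_sub bandxwx.
have sizeM_lt a b : (a * b)%g != a -> (#|lideal (a * b)%g| < #|lideal a|)%N.
  move=> ab; apply: proper_card; rewrite properE !lideal_sub bandxwx eqxx /=.
  by rewrite mulgA bandxx.
have ind n : exists e, forall a, (#|lideal a| < n)%N -> ok e a.
  elim: n => [|n [e0 e0P]]; first by exists 0.
  have inner (s : seq B) : exists e, forall a,
      (#|lideal a| < n)%N || ((#|lideal a| == n) && (a \in s)) -> ok e a.
    elim: s => [|b s [e eP]].
      by exists e0 => a; rewrite andbF orbF; apply: e0P.
    have [bn|bn] := eqVneq #|lideal b| n; last first.
      exists e => a; rewrite inE; have [->|_] := eqVneq a b; last exact: eP.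
      by rewrite (negPf bn) /= orbF => lt; apply: eP; rewrite lt.
    exists (e + pt b - conv (pt b) e) => a aP D.
    rewrite !evDl evNl ev_conv !ev_pt.
    have [ab|ab] := eqVneq (a * b)%g a; last first.
      have lt : (#|lideal (a * b)%g| < n)%N.
        apply: leq_trans (sizeM_lt _ _ ab) _.
        by case/orP: aP => [/ltnW//|/andP[/eqP->]].
      have -> : ev e (fun b0 => D (a * (b * b0))%g) = D (a * b)%g.
        rewrite -(eP (a * b)%g) ?lt //.
        by apply: eq_ev => c; rewrite mulgA.
      rewrite addrK; apply: eP; case/orP: aP => [->//|/andP[an]].
      rewrite inE => /orP[/eqP ab'|->]; last by rewrite an orbT.
      by move: ab; rewrite ab' bandxx eqxx.
    have -> : ev e (fun b0 => D (a * (b * b0))%g) = ev e (fun b0 => D (a * b0)%g).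
      by apply: eq_ev => c; rewrite mulgA ab.
    by rewrite ab addrC addrA addNr add0r.
  have [e eP] := inner (enum B); exists e => a; rewrite ltnS leq_eqVlt => an.
  by apply: eP; rewrite mem_enum andbT orbC.
have [e eP] := ind #|B|.+1; exists e => a; apply: eP.
by rewrite ltnS max_card.
Qed.

Lemma connected_const (X : Lam B) D :
  (forall a b, a \in upset X -> b \in upset X -> band_le a b -> D a = D b) ->
  {in upset X &, forall a b, D a = D b}.
Proof.
move=> Dle a b aX bX.
set K := order_complex (@band_le B) (upset X).
pose r : rel B := [rel x y | [set x; y] \in K].
have vK x : ([set x] \in K) = (x \in upset X).
  rewrite inE -card_gt0 cards1 sub1set /=; case: (x \in _) => //=.
  apply/'forall_implyP => y /set1P->; apply/'forall_implyP => z /set1P->.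
  by rewrite /band_le bandxx eqxx.
have rK x y : r x y -> [/\ x \in upset X, y \in upset X & band_le x y || band_le y x].
  rewrite /r /= inE => /and3P[_ /subsetP sX /'forall_implyP H].
  split; [exact/sX/set21|exact/sX/set22|].
  by have /'forall_implyP/(_ y (set22 _ _)) := H x (set21 _ _).
have rC : connect_sym r by apply: sym_connect_sym => x y; rewrite /r /= setUC.
have rD x y : connect r x y -> D x = D y.
  case/connectP => p; elim: p x => [|z p IH] x /=; first by move=> _ ->.
  case/andP=> /rK[xX zX xz] pz yE; rewrite -(IH z) //.
  by case/orP: xz => [/Dle->//|/Dle <-].
have cl : closed r (mem (upset X)) by apply: intro_closed => // x y /rK[].
have rX x : x \in upset X -> fingraph.root r x \in predI (roots r) [pred x | [set x] \in K].
  move=> xX; apply/andP; split; first exact: roots_root.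
  change ([set fingraph.root r x] \in K); rewrite vK.
  by rewrite -(closed_connect cl (connect_root r x)).
have [z Kz] := mem_card1 (lrb_connected X).
have rz x : x \in upset X -> fingraph.root r x = z by move=> /rX; rewrite Kz => /eqP.
by rewrite (rD _ _ (connect_root r a)) (rD _ _ (connect_root r b)) !rz.
Qed.



(* This is where connectedness is used. If D is nonzero, then the left B-module
   generated by D has a vector, again called D, on which every a in B acts as 1
   or 0, according to whether Ba contains some fixed X or not. Then D vanishes
   outside B_{>=X} and is takes equal values on comparable elements on B_{>=X}, hence
   constant there; pairing with e shows that the constant is 0. *)
Lemma right_ann_eq0 e D :
  (forall a F, ev e (fun b => F (a * b)%g) = F a) ->
  (forall a, ev e (fun b => D (b * a)%g) = 0) -> forall a, D a = 0.
Proof.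
move=> eP.
pose T (F : B -> k) := [set c | [exists x, exists a, F (x * c * a)%g != 0]].
have TP (F : B -> k) c x a : c \notin T F -> F (x * c * a)%g = 0.
  rewrite inE negb_exists => /forallP/(_ x).
  by rewrite negb_exists => /forallP/(_ a); rewrite negbK => /eqP.
have TP1 (F : B -> k) c x : c \notin T F -> F (x * c)%g = 0.
  by move=> cT; rewrite -[c]bandxx mulgA TP.
move: {2}#|T D|.+1 (ltnSn #|T D|) => n.
elim: n D => // n IH D; rewrite ltnS => Tn DU y; apply/eqP/negPn/negP => Dy.
have yT : y \in T D.
  by rewrite inE; apply/existsP; exists y; apply/existsP; exists y; rewrite !bandxx.
case: (@arg_minnP _ y (fun c => c \in T D) (fun c => #|lideal c|) yT) => b bT bmin.
have small c : (c * b)%g = c -> (b * c)%g != b -> c \notin T D.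
  move=> cb bc; apply/negP => /bmin; apply/negP; rewrite -ltnNge.
  by apply: proper_card; rewrite properE !lideal_sub cb eqxx.
have IHb (F : B -> k) : (forall a, ev e (fun b => F (b * a)%g) = 0) ->
    T F \subset T D -> b \notin T F -> forall x, F x = 0.
  move=> FU TF bF; apply: IH => //; apply: leq_trans Tn; apply: proper_card.
  by rewrite properE TF; apply/subsetPn; exists b.
have Tsub (F : B -> k) : (forall c, c \notin T D -> forall x a, F (x * c * a)%g = 0) ->
    T F \subset T D.
  move=> H; apply/subsetP => c; apply: contraTT => /H{}H.
  by rewrite inE negb_exists; apply/forallP => x; rewrite negb_exists;
    apply/forallP => a; rewrite H eqxx.
have notT (F : B -> k) c : (forall x a, F (x * c * a)%g = 0) -> c \notin T F.
  by move=> H; rewrite inE negb_exists; apply/forallP => x; rewrite negb_exists;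
    apply/forallP => a; rewrite H eqxx.
have lrb (x z : B) : (x * z * x)%g = (x * z)%g by exact: bandxyx.
have up a : (b * a)%g = b -> forall x, D (x * a)%g = D x.
  move=> ba x; apply/eqP; rewrite -subr_eq0; apply/eqP; move: x.
  apply: (IHb (fun x => D (x * a)%g - D x)) => [c||].
  - rewrite evBr DU subr0 -[RHS](DU (c * a)%g).
    by apply: eq_ev => z; rewrite mulgA.
  - by apply: Tsub => c cT x z; rewrite -(mulgA (x * c)%g) !TP ?subr0.
  - apply: notT => x c; have [bcb|bcb] := eqVneq (b * c)%g b.
      by rewrite -(mulgA x b c) bcb -(mulgA x b a) ba subrr.
    have bcT : (b * c)%g \notin T D.
      by apply: small; rewrite ?lrb // mulgA bandxx.
    by rewrite -(mulgA x b c) TP // TP1 // subr0.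
have dn a : (b * a)%g != b -> forall x, D (x * a)%g = 0.
  move=> ba; apply: IHb => [c||].
  - by rewrite -[RHS](DU (c * a)%g); apply: eq_ev => z; rewrite mulgA.
  - by apply: Tsub => c cT x z; rewrite -(mulgA (x * c)%g) TP.
  - apply: notT => x c.
    have bcaT : (b * c * a)%g \notin T D.
      apply: small; first by rewrite -(mulgA b c a) lrb.
      rewrite !mulgA bandxx; apply: contraNneq ba => bca.
      by rewrite -{1}bca -(mulgA _ a a) bandxx bca.
    by rewrite -(mulgA x b c) -(mulgA x _ a) (TP1 _ _ _ bcaT).
have Dup a : D a = ((b * a)%g == b)%:R * D a.
  have [ba|ba] := eqVneq; first by rewrite mul1r.
  by rewrite mul0r -[a]bandxx dn.
pose X := MkLam (introT existsP (ex_intro _ b (eqxx (lideal b)))).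
have upX a : (a \in upset X) = ((b * a)%g == b) by rewrite inE /= lideal_sub.
have Dconst a : (b * a)%g = b -> D a = D b.
  move=> ba; apply: (@connected_const X); rewrite ?upX ?ba ?bandxx // => c d.
  by rewrite !upX => /eqP bc _ /eqP dc; rewrite -{1}dc up.
have Db : D b = 0.
  rewrite -[RHS](DU b); transitivity (ev e (fun z => ((b * z)%g == b)%:R * D b)).
    by rewrite (eP b (fun z => (z == b)%:R * D b)) eqxx mul1r.
  apply: eq_ev => z; rewrite (up _ (bandxx b)) [RHS]Dup.
  by have [/Dconst->|_] := eqVneq (b * z)%g b; rewrite ?mul0r.
by move/negP: Dy; apply; rewrite Dup; have [/Dconst->|_] := eqVneq (b * y)%g b;
  rewrite ?Db ?mulr0 ?mul0r.
Qed.

Lemma conv_unit : exists e, [forall b, (conv e (pt b) == pt b) && (conv (pt b) e == pt b)].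
Proof.
have [e eP] := conv_right_id; exists e; apply/forallP => a; apply/andP; split.
  apply/eqP/ev_inj => D; rewrite ev_conv ev_pt; apply/eqP.
  rewrite -subr_eq0; apply/eqP.
  rewrite (eq_ev _ (D' := fun b => D (b * a)%g)) => [|b]; last by rewrite ev_pt.
  move: a; apply: (right_ann_eq0 (D := fun x => ev e (fun b => D (b * x)%g) - D x) eP).
  move=> c; rewrite evBr; apply/eqP; rewrite subr_eq0; apply/eqP.
  rewrite ev_exchange; apply: eq_ev => a.
  by rewrite -[RHS](eP a (fun z => D (z * c)%g)); apply: eq_ev => b; rewrite mulgA.
by apply/eqP/ev_inj => D; rewrite ev_conv !ev_pt eP.
Qed.
End Convolution.

Section Algebra.
Variables (k : fieldType) (B : clrbType).

(* The band algebra: [f] stands for the linear combination of the b in B with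
   coefficients f b. *)
Definition balg : Type := {ffun B -> k}.

HB.instance Definition _ := GRing.Zmodule.on balg.

Definition balg_scale (c : k) (f : balg) : balg := [ffun b => c * f b].

Let scaleA c c' f : balg_scale c (balg_scale c' f) = balg_scale (c * c') f.
Proof. by apply/ffunP => b; rewrite !ffunE mulrA. Qed.

Let scale1 : left_id 1 balg_scale.
Proof. by move=> f; apply/ffunP => b; rewrite !ffunE mul1r. Qed.

Let scaleDr : right_distributive balg_scale +%R.
Proof. by move=> c f g; apply/ffunP => b; rewrite !ffunE mulrDr. Qed.

Let scaleDl f : {morph balg_scale^~ f : c c' / c + c'}.
Proof. by move=> c c'; apply/ffunP => b; rewrite !ffunE mulrDl. Qed.

HB.instance Definition _ := GRing.Zmodule_isLmodule.Build k balg
  scaleA scale1 scaleDr scaleDl.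

Definition balg_one : balg := xchoose (conv_unit B k).

Let mul1f : left_id balg_one (@conv B k : balg -> balg -> balg).
Proof.
have /forallP one1 := xchooseP (conv_unit B k).
move=> f; apply: ev_inj => D; rewrite ev_conv.
rewrite ev_exchange; apply: eq_ev => b.
have /andP[/eqP e1 _] := one1 b.
rewrite -[RHS](ev_pt b D) -e1 ev_conv; apply: eq_ev => a; by rewrite ev_pt.
Qed.

Let mulf1 : right_id balg_one (@conv B k : balg -> balg -> balg).
Proof.
have /forallP one1 := xchooseP (conv_unit B k).
move=> f; apply: ev_inj => D; rewrite ev_conv; apply: eq_ev => b.
have /andP[_ /eqP e1] := one1 b.
by rewrite -[RHS](ev_pt b D) -e1 ev_conv ev_pt.
Qed.

Let one_neq0 : balg_one != 0.
Proof.
have [b _] := @band_inhabited B; apply/eqP => one0.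
have /ffunP/(_ b) := mul1f (pt k b); rewrite one0.
have -> : conv (0 : balg) (pt k b) = 0.
  by have := convDl (0 : balg) 0 (pt k b); rewrite addr0 => /eqP; rewrite -subr_eq0 opprD addNKr oppr_eq0 => /eqP.
by rewrite !ffunE eqxx => /esym/eqP; rewrite oner_eq0.
Qed.

HB.instance Definition _ := GRing.Zmodule_isNzRing.Build balg
  (@convA B k) mul1f mulf1 (@convDl B k) (@convDr B k) one_neq0.

Let scaleAl (c : k) (f g : balg) : c *: (f * g) = (c *: f) * g.
Proof.
apply/ffunP => b; rewrite !ffunE mulr_sumr; apply: eq_bigr => p _.
by rewrite ffunE mulrA.
Qed.

Let scaleAr (c : k) (f g : balg) : c *: (f * g) = f * (c *: g).
Proof.
apply/ffunP => b; rewrite !ffunE mulr_sumr; apply: eq_bigr => p _.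
by rewrite ffunE mulrCA.
Qed.

HB.instance Definition _ := GRing.Lmodule_isLalgebra.Build k balg scaleAl.
HB.instance Definition _ := GRing.Lalgebra_isAlgebra.Build k balg scaleAr.

(* The module k_X: b acts as 1 if Bb contains X and as 0 otherwise, extended
   linearly to the band algebra. *)
Definition kmod (X : Lam B) : Type := k.

Section OneDim.
Variable X : Lam B.

HB.instance Definition _ := GRing.Zmodule.on (kmod X).

Definition kmod_scale (f : balg) (v : kmod X) : kmod X := (\sum_(b in upset X) f b) * v.

Let chiE (f : balg) : \sum_(b in upset X) f b = ev f (fun b => (b \in upset X)%:R).
Proof. by rewrite big_mkcond; apply: eq_bigr => b _; case: ifP; rewrite ?mulr1 ?mulr0. Qed.

Lemma upsetM (a b : B) : ((a * b)%g \in upset X) = (a \in upset X) && (b \in upset X).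
Proof.
have /existsP[x /eqP Xx] := lam_principal X.
rewrite !inE Xx !lideal_sub; apply/eqP/andP => [xab|[/eqP xa /eqP xb]].
  have xa : (x * a)%g = x by rewrite -{1}xab -[LHS]mulgA bandxwx.
  by split; apply/eqP => //; rewrite -[RHS]xab mulgA xa.
by rewrite mulgA xa.
Qed.

Let kmod_scaleA f g v : kmod_scale f (kmod_scale g v) = kmod_scale (f * g) v.
Proof.
rewrite /kmod_scale mulrA; congr (_ * _); rewrite !chiE ev_conv mulr_suml.
apply: eq_bigr => a _; rewrite -mulrA mulr_sumr; congr (_ * _).
by apply: eq_bigr => b _; rewrite upsetM mulrCA -natrM mulnb.
Qed.

Let kmod_scale1 : left_id 1 kmod_scale.
Proof.
move=> v; rewrite /kmod_scale; suff -> : \sum_(b in upset X) (1 : balg) b = 1 by rewrite mul1r.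
have /existsP[x /eqP Xx] := lam_principal X.
have xX : x \in upset X by rewrite inE Xx.
have /(congr1 (fun f => ev f (fun b => (b \in upset X)%:R))) := mulf1 (pt k x).
rewrite ev_conv !ev_pt chiE xX => /(etrans _); apply.
by apply: eq_ev => b; rewrite upsetM xX.
Qed.

Let kmod_scaleDr : right_distributive kmod_scale +%R.
Proof. by move=> f u v; rewrite /kmod_scale mulrDr. Qed.

Let kmod_scaleDl v : {morph kmod_scale^~ v : f g / f + g}.
Proof. by move=> f g; rewrite /kmod_scale !chiE evDl mulrDl. Qed.

HB.instance Definition _ := GRing.Zmodule_isLmodule.Build balg (kmod X)
  kmod_scaleA kmod_scale1 kmod_scaleDr kmod_scaleDl.

End OneDim.
End Algebra.

Section Homological.
Variable R : nzRingType.

Definition mod_iso (M N : lmodType R) : Prop := exists f : {linear M -> N}, bijective f.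

Definition simple_mod (M : lmodType R) : Prop :=
  (exists x : M, x != 0) /\
  (forall S : {pred M}, submod_closed S -> (S =i pred1 0) \/ (S =i predT)).

Definition projective (P : lmodType R) : Prop :=
  forall (M N : lmodType R) (g : {linear M -> N}) (f : {linear P -> N}),
    (forall y, exists x, g x = y) ->
    exists h : {linear P -> M}, forall x, g (h x) = f x.

Record proj_resolution (M : lmodType R) : Type := ProjResolution {
  res :> nat -> lmodType R;
  res_d : forall n, {linear res n.+1 -> res n};
  res_aug : {linear res 0 -> M};
  res_projective : forall n, projective (res n);
  res_aug_surj : forall y, exists x, res_aug x = y;
  res_exact0 : forall x, res_aug x = 0 <-> exists y, res_d 0 y = x;
  res_exact : forall n (x : res n.+1), res_d n x = 0 <-> exists y, res_d n.+1 y = x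
}.

Section Free.
Variables (K : choiceType) (M : lmodType R) (h : K -> M).

Definition free_lift (g : {malg R[K]}) : M := \sum_(x <- msupp g) g@_x *: h x.

Lemma free_liftEw (d : {fset K}) g : (msupp g `<=` d)%fset ->
  free_lift g = \sum_(x <- d) g@_x *: h x.
Proof.
move=> le; rewrite /free_lift; apply: big_fset_incl => // x xd /mcoeff_outdom ->.
by rewrite scale0r.
Qed.

Lemma free_lift_linear : linear free_lift.
Proof.
move=> a u v; pose d := (msupp u `|` msupp v `|` msupp (a *: u + v))%fset.
rewrite !(@free_liftEw d); last 3 first.
- by rewrite /d -fsetUA fsetUCA fsubsetUl.
- by rewrite /d -fsetUA fsubsetUl.
- by rewrite /d fsubsetUr.
rewrite scaler_sumr -big_split; apply: eq_bigr => x _.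
by rewrite mcoeffD mcoeffZ scalerDl scalerA.
Qed.

HB.instance Definition _ :=
  GRing.isLinear.Build R {malg R[K]} M _ free_lift free_lift_linear.

Lemma free_liftU x : free_lift << x >> = h x.
Proof. by rewrite (free_liftEw (msuppU_le)) big_seq_fset1 mcoeffUU scale1r. Qed.

End Free.

Lemma free_projective (K : choiceType) : projective {malg R[K]}.
Proof.
move=> M N g f g_surj.
have gP x : exists y, g y == f << x >> by have [y <-] := g_surj (f << x >>); exists y.
exists (@free_lift K M (fun x => xchoose (gP x))) => u.
rewrite /= {1}/free_lift [in RHS](monalgE u) !raddf_sum; apply: eq_bigr => x _ /=.
rewrite linearZ (eqP (xchooseP (gP x))) -linearZ; congr (f _).
by apply/malgP => z; rewrite mcoeffZ !mcoeffU mulrnAr mulr1.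
Qed.

(* There are enough projectives, so the quantification over all projective
   resolutions in [ext1_dim] below is never vacuous. *)
Lemma proj_resolution_exists (M : lmodType R) : inhabited (proj_resolution M).
Proof.
pose ker (P Q : lmodType R) (f : {linear P -> Q}) : choiceType := {x : P | f x == 0}.
pose cov (P Q : lmodType R) (f : {linear P -> Q}) : {linear {malg R[ker P Q f]} -> P} :=
  free_lift (sval : ker P Q f -> P).
have covP (P Q : lmodType R) (f : {linear P -> Q}) x :
    f x = 0 <-> exists y, cov P Q f y = x.
  split=> [fx|[y <-]].
    by exists << (exist _ x (introT eqP fx) : ker P Q f) >>; rewrite /cov /= free_liftU.
  rewrite /cov /= raddf_sum big1 //= => z _.
  by rewrite linearZ /= (eqP (svalP z)) scaler0.
pose stage := {P : lmodType R & {Q : lmodType R & {linear P -> Q}}}.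
pose src (s : stage) := projT1 s.
pose tgt (s : stage) := projT1 (projT2 s).
pose arr (s : stage) : {linear src s -> tgt s} := projT2 (projT2 s).
pose next (s : stage) : stage :=
  existT _ ({malg R[ker _ _ (arr s)]} : lmodType R) (existT _ (src s) (cov _ _ (arr s))).
pose s0 : stage := existT _ ({malg R[M]} : lmodType R)
  (existT _ M (free_lift (id : M -> M) : {linear _ -> _})).
pose st n := iter n next s0.
constructor; apply: (@ProjResolution M (fun n => src (st n))
  (fun n => arr (st n.+1)) (arr s0)).
- by case=> [|n]; apply: free_projective.
- by move=> y; exists << y >>; rewrite /= free_liftU.
- exact: covP.
- by move=> n; apply: covP.
Qed.

End Homological.

Section Quiver.
Variables (k : fieldType) (A : algType k).

(* dim_k Ext^1_A(M, N) = n. As usual Ext^1_A(M, N) is H^1 of the complex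
   Hom_A(P, N), for P a projective resolution of M (the choice of P does not
   matter): its 1-cocycles are the f : P_1 -> N that vanish on the image of P_2,
   its 1-coboundaries the g \o d_0 with g : P_0 -> N. The family z is a k-basis
   of the cocycles modulo the coboundaries; c in k acts on N as c%:A in A. *)
Definition ext1_dim (M N : lmodType A) (n : nat) : Prop :=
  forall P : proj_resolution M,
  exists z : 'I_n -> {linear P 1%N -> N},
    (forall i x, z i (res_d P 1 x) = 0) /\
    (forall f : {linear P 1%N -> N}, (forall x, f (res_d P 1 x) = 0) ->
       exists! c : 'rV[k]_n, exists g : {linear P 0%N -> N},
         forall x, f x = \sum_i (c 0 i)%:A *: z i x + g (res_d P 0 x)).

(* [V], realized by the modules [S v], is the vertex set of the Gabriel quiver of
   A, and [arrows v w] is its number of arrows v -> w: the S v represent every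
   isomorphism class of simple modules exactly once. *)
Definition is_gabriel_quiver (V : Type) (S : V -> lmodType A)
    (arrows : V -> V -> nat) : Prop :=
  [/\ forall v, simple_mod (S v),
      forall M : lmodType A, simple_mod M -> exists v, mod_iso M (S v),
      forall v w, mod_iso (S v) (S w) -> v = w
    & forall v w, ext1_dim (S v) (S w) (arrows v w)].

End Quiver.

(* The order of Lambda(B) is inclusion. *)
Definition Lam_lt (B : lrbType) (X Y : Lam B) : bool := (X : {set B}) \proper Y.

(* [partial_upset e X] is e B_{>=X} minus e. *)
Definition partial_upset (B : lrbType) (e : B) (X : Lam B) : {set B} :=
  [set (e * b)%g | b in upset X] :\ e.

(* Main.v *)
(** The 1-cocycles of a projective resolution P of k_X with values in k_Y correspond to
    derivations D : B -> k, D(ab) = chi_Y(a) D(b) + D(a) chi_X(b), where chi_X(b) is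
    the scalar by which b acts on k_X: choosing u in P_0 over 1, a cocycle f gives
    D(b) = f(w_b), where w_b is a preimage of bu - chi_X(b)u in P_1; conversely, projectivity of P_0 lifts the
    augmentation to the extension defined by D. Coboundaries correspond to the
    multiples of chi_Y - chi_X, so Ext^1(k_X, k_Y) is the space of derivations
    modulo this line.

    A derivation vanishes at the b with chi_X(b) = chi_Y(b). If X < Y, it is
    determined by its values on the boundary of e_Y B_{>=X}, and the functions so
    obtained are those that are constant on connected components; the inner
    derivation is a nonzero constant there. If X is not below Y, take y with
    By = Y; comparing D(yb) with D(yby) gives D = D(y) (chi_Y - chi_X).

    A simple module is some k_X: if b acts as nonzero on M and Bb is minimal for
    this, then ba acts as chi_X(a) b, where X = Bb, so the kernel of b is a proper
    submodule, hence zero, and a acts as chi_X(a). *)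

Require Import Defs.
From HB Require Import structures.
From mathcomp Require Import all_boot all_order all_algebra.
From mathcomp Require Import monoid boolp ring.

Set Implicit Arguments.
Unset Strict Implicit.
Unset Printing Implicit Defensive.

Import GRing.Theory.
Local Open Scope ring_scope.

(** Bundles maps that are given pointwise, by a formula or by choice, as linear maps. *)
Lemma linear_exists (R : nzRingType) (M N : lmodType R) (f : M -> N) :
  linear f -> exists F : {linear M -> N}, F =1 f.
Proof.
move=> f_lin; pose L := GRing.isLinear.Build R M N *:%R f f_lin.
by exists (HB.pack f L : {linear M -> N}).
Qed.

(** * Characters of the band and the modules k_X *)

Section BandAlgebra.
Variables (B : clrbType) (k : fieldType).
Implicit Types (X Y : Lam B) (a b c : B) (f g : balg k B) (D : B -> k).
Local Notation A := (balg k B).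
Local Notation pt b := (pt k b : A).

Definition chi X b : k := (b \in upset X)%:R.

Lemma chiM X a b : chi X (a * b)%g = chi X a * chi X b.
Proof. by rewrite /chi upsetM -natrM mulnb. Qed.

Lemma kmodE X f (v : kmod k X) : f *: v = ev f (chi X) * v.
Proof.
congr (_ * _); rewrite [LHS]big_mkcond; apply: eq_bigr => b _.
by rewrite /chi; case: ifP; rewrite ?mulr1 ?mulr0.
Qed.

Lemma balg_sum_pt f : f = \sum_b f b *: pt b.
Proof.
apply/ffunP => c; rewrite sum_ffunE (bigD1 c) //= big1 => [|b /negPf bc].
  by rewrite !ffunE eqxx mulr1 addr0.
by rewrite !ffunE eq_sym bc mulr0.
Qed.

Lemma ptM a b : pt a * pt b = pt (a * b)%g.
Proof. by apply: ev_inj => D; rewrite ev_conv !ev_pt. Qed.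

Lemma evZ t f D : ev (t *: f) D = t * ev f D.
Proof. by rewrite /ev mulr_sumr; apply: eq_bigr => b _; rewrite ffunE mulrA. Qed.

Lemma ev_chiM X f g : ev (f * g) (chi X) = ev f (chi X) * ev g (chi X).
Proof.
rewrite ev_conv mulr_suml; apply: eq_bigr => a _; rewrite -[RHS]mulrA; congr (_ * _).
by rewrite [RHS]mulr_sumr; apply: eq_bigr => b _; rewrite chiM mulrCA.
Qed.

Lemma ev_chi1 X : ev (1 : A) (chi X) = 1.
Proof. by have := scale1r (1 : kmod k X); rewrite kmodE mulr1. Qed.

Lemma Lam_repr X : exists x, lideal x = X.
Proof. by have /existsP[x /eqP ->] := lam_principal X; exists x. Qed.

Lemma mem_upset X x b : lideal x = X -> (b \in upset X) = ((x * b)%g == x).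
Proof. by move=> xX; rewrite inE -xX lideal_sub. Qed.

Lemma upset_sub X Y x : lideal x = X -> (x \in upset Y) = (Y \subset X).
Proof. by move=> xX; rewrite inE xX. Qed.

(** A generator of Y lies in B_{>=X} exactly when X is contained in Y, so equal upper sets give both
    inclusions. *)
Lemma upset_inj : injective (@upset B).
Proof.
have sub X Y : upset X = upset Y -> X \subset Y.
  move=> XY; have [y yY] := Lam_repr Y.
  by rewrite -(upset_sub _ yY) XY (upset_sub _ yY).
by move=> X Y XY; apply/val_inj/eqP; rewrite eqEsubset /= !sub.
Qed.

Lemma scalarE X (t : k) (v : kmod k X) : t%:A *: v = t * v.
Proof. by rewrite kmodE evZ ev_chi1 mulr1. Qed.

Lemma kmod_simple X : simple_mod (kmod k X).
Proof.
split; first by exists (1 : k); rewrite oner_neq0.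
move=> S [S0 S_lin].
have [[v /andP[Sv v0]]|noS] := pselect (exists v : kmod k X, (v \in S) && (v != 0)).
  right=> w; rewrite [RHS]inE.
  have := S_lin (w / v : k)%:A v 0 Sv S0.
  by rewrite addr0 scalarE (divfK v0).
left=> v; apply/idP/eqP => [Sv|->//]; apply/eqP/negPn/negP => v0.
by apply: noS; exists v; rewrite Sv.
Qed.

(** The image of 1 is a nonzero vector on which each [b] acts both by [chi X b] and by [chi Y b];
    these are 0 or 1, hence they determine the upper sets. *)
Lemma kmod_iso_inj X Y : mod_iso (kmod k X) (kmod k Y) -> X = Y.
Proof.
case=> f [g fK gK]; apply/upset_inj/setP => b.
have f1 : f (1 : k) != 0.
  by rewrite -(raddf0 f) (inj_eq (can_inj fK)) oner_neq0.
have /eqP := linearZ_LR f (pt b) (1 : k).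
rewrite !kmodE !ev_pt mulr1 => /eqP fb.
have : chi X b * f (1 : k) = chi Y b * f (1 : k).
  rewrite -fb -scalarE -linearZ /= scalarE mulr1; congr (f _).
move/(mulIf f1); rewrite /chi; case: (b \in _); case: (b \in _) => // /eqP;
  by rewrite ?oner_eq0 // eq_sym oner_eq0.
Qed.

Lemma scaler_algl (M : lmodType A) t f (m : M) : (t *: f) *: m = t%:A *: (f *: m).
Proof. by rewrite scalerA mulr_algl. Qed.

Lemma scaler_alg_comm (M : lmodType A) t f (m : M) :
  f *: (t%:A *: m) = t%:A *: (f *: m).
Proof. by rewrite !scalerA mulr_algl mulr_algr. Qed.

(** * Classification of the simple modules *)

Section Simple.
Variables (M : lmodType A) (M_simple : simple_mod M).
Implicit Types m : M.

Lemma simple_minimal :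
  exists2 b, exists m, pt b *: m != 0
  & forall c, (exists m, pt c *: m != 0) -> (#|lideal b| <= #|lideal c|)%N.
Proof.
pose nz c := `[< exists m, pt c *: m != 0 >].
have [b0 b0nz] : exists b, nz b.
  have [[x x0] _] := M_simple; apply: contrapT => no_b; move/eqP: x0; apply.
  rewrite -[x]scale1r (balg_sum_pt 1) scaler_suml big1 // => b _.
  rewrite scaler_algl; suff -> : pt b *: x = 0 by rewrite scaler0.
  by apply/eqP/negPn/negP => bx; apply: no_b; exists b; apply/asboolP; exists x.
case: (@arg_minnP _ b0 nz (fun c => #|lideal c|) b0nz) => b /asboolP b_nz b_min.
by exists b => // c /asboolP/b_min.
Qed.

Lemma simple_acts : exists X, forall a m, pt a *: m = (chi X a)%:A *: m.
Proof.
have [b [m0 bm0] b_min] := simple_minimal.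
have [X bX] : exists X : Lam B, lideal b = X.
  by exists (MkLam (introT existsP (ex_intro _ b (eqxx (lideal b))))).
(* If ba differs from b, it generates a strictly smaller left ideal, so by minimality it acts as
   zero. *)
have pt_ab a m : pt b *: (pt a *: m) = (chi X a)%:A *: (pt b *: m).
  rewrite scalerA ptM /chi (mem_upset _ bX); have [->|ba] := eqVneq.
    by rewrite !scale1r.
  rewrite !scale0r; apply/eqP/negPn/negP => bam.
  have := b_min (b * a)%g (ex_intro _ m bam); apply/negP; rewrite -ltnNge.
  apply: proper_card; rewrite properE !lideal_sub mulgA bandxx ba andbT.
  by rewrite bandxyx eqxx.
have ker_sub : submod_closed [pred m : M | pt b *: m == 0].
  split=> [|f u v]; rewrite !inE ?scaler0 // => /eqP bu /eqP bv.
  rewrite scalerDr bv addr0 (balg_sum_pt f) scaler_suml scaler_sumr big1 // => a _.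
  by rewrite scaler_algl scaler_alg_comm pt_ab bu !scaler0.
exists X => a m; have [_ /(_ _ ker_sub)[ker0|kerT]] := M_simple; last first.
  by have := kerT m0; rewrite !inE (negPf bm0).
apply/eqP; rewrite -subr_eq0; have := ker0 (pt a *: m - (chi X a)%:A *: m).
by rewrite !inE => <-; rewrite scalerBr scaler_alg_comm pt_ab subrr.
Qed.

(** Every algebra element acts as a scalar, so the k-line through a nonzero [x] is a submodule and
    hence all of M; the coordinate along [x] is the isomorphism. *)
Lemma simple_kmod : exists X, mod_iso M (kmod k X).
Proof.
have [X actX] := simple_acts; exists X; have [[x x0] sub] := M_simple.
have act f m : f *: m = (ev f (chi X))%:A *: m.
  rewrite {1}(balg_sum_pt f) scaler_suml [ev _ _]/ev !scaler_suml.
  by apply: eq_bigr => a _; rewrite scaler_algl actX -scaler_algl scalerA.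
have line_sub : submod_closed [pred m : M | `[< exists t : k, t%:A *: x = m >]].
  split=> [|f u v]; rewrite !inE.
    by apply/asboolP; exists 0; rewrite !scale0r.
  move=> /asboolP[t <-] /asboolP[s <-]; apply/asboolP.
  exists (ev f (chi X) * t + s); rewrite (act f) -scaler_algl scalerA.
  by rewrite -scalerDl -scalerDl.
have [line0|lineT] := sub _ line_sub.
  have := line0 x; rewrite !inE (negPf x0) => /asboolP[].
  by exists 1; rewrite !scale1r.
have xP m : exists t : k, t%:A *: x == m.
  by have := lineT m; rewrite !inE => /asboolP[t <-]; exists t.
have xinj t s : t%:A *: x = s%:A *: x -> t = s.
  move/eqP; rewrite -subr_eq0 -scalerBl -scalerBl => /eqP tsx.
  apply/eqP; rewrite -subr_eq0; apply: contraNT x0 => ts0.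
  by rewrite -[x]scale1r -[1 : A]scale1r -(mulVf ts0) -[_ *: 1]scalerA scaler_algl
    tsx scaler0.
have [//|F FE] := @linear_exists _ M (kmod k X) (fun m => xchoose (xP m)).
  move=> f u v; rewrite kmodE; apply: xinj.
  rewrite (eqP (xchooseP (xP (f *: u + v)))) !scalerDl -[(_ * _)%:A]scalerA.
  by rewrite scaler_algl (eqP (xchooseP (xP u))) (eqP (xchooseP (xP v))) -act.
exists F; exists (fun t : k => t%:A *: x) => [m|t].
  by rewrite FE (eqP (xchooseP (xP m))).
by rewrite FE; apply: xinj; rewrite (eqP (xchooseP (xP _))).
Qed.
End Simple.
End BandAlgebra.

(** * Derivations and the extensions of k_X by k_Y that they define *)

Section Derivations.
Variables (B : clrbType) (k : fieldType) (X Y : Lam B).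
Local Notation A := (balg k B).
Local Notation V := {ffun B -> k^o}.
Local Notation pt b := (pt k b : A).
Implicit Types (D : V).

Definition der_defect D : {ffun B * B -> k^o} :=
  [ffun p => D (p.1 * p.2)%g - (chi k Y p.1 * D p.2 + D p.1 * chi k X p.2)].

Lemma der_defect_linear : linear der_defect.
Proof.
move=> t D D'; apply/ffunP => p; rewrite !ffunE /GRing.scale /=.
by ring.
Qed.

HB.instance Definition _ :=
  GRing.isLinear.Build k V {ffun B * B -> k^o} _ der_defect der_defect_linear.

(** Taking a kernel makes the derivations a subspace, whose dimension can be counted. *)
Definition der : {vspace V} := lker (linfun der_defect).

Lemma derP D :
  reflect (forall a b, D (a * b)%g = chi k Y a * D b + D a * chi k X b) (D \in der).
Proof.
rewrite memv_ker lfunE; apply: (iffP eqP) => [D0 a b | der_D].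
  by have /eqP := congr1 (fun E : {ffun _} => E (a, b)) D0; rewrite !ffunE subr_eq0 => /eqP.
by apply/ffunP => p; rewrite !ffunE der_D subrr.
Qed.

Definition inner_der : V := [ffun b => chi k Y b - chi k X b].

Lemma inner_der_der : inner_der \in der.
Proof. by apply/derP => a b; rewrite !ffunE !chiM mulrBr mulrBl addrA subrK. Qed.

(** The Leibniz rule extends bilinearly to the algebra; this makes the triangular action [ext_scale]
    associative. *)
Lemma ev_derM D (f g : A) : D \in der ->
  ev (f * g) D = ev f (chi k Y) * ev g D + ev f D * ev g (chi k X).
Proof.
move/derP=> der_D; rewrite ev_conv [ev f _ * _]mulr_suml [ev f _ * _]mulr_suml.
rewrite -big_split; apply: eq_bigr => a _ /=; rewrite -!mulrA -mulrDr; congr (_ * _).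
rewrite mulr_sumr mulr_sumr -big_split; apply: eq_bigr => b _ /=.
by rewrite der_D mulrDr; congr (_ + _); rewrite mulrCA.
Qed.

Lemma ev_der1 D : D \in der -> ev (1 : A) D = 0.
Proof.
move=> /(ev_derM 1 1); rewrite mulr1 !ev_chi1 mul1r mulr1.
by move/eqP; rewrite -subr_eq0 opprD addrA subrr sub0r oppr_eq0 => /eqP.
Qed.

Lemma ev_inner_der (f : A) : ev f inner_der = ev f (chi k Y) - ev f (chi k X).
Proof. by rewrite -evBr; apply: eq_ev => b; rewrite ffunE. Qed.

Lemma evDr (f : A) D D' : ev f (D + D') = ev f D + ev f D'.
Proof. by rewrite -big_split; apply: eq_bigr => b _; rewrite ffunE mulrDr. Qed.

Lemma evZr t (f : A) D : ev f (t *: D) = t * ev f D.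
Proof. by rewrite [RHS]mulr_sumr; apply: eq_bigr => b _; rewrite ffunE mulrCA. Qed.

Section Extension.
Variables (D : V) (der_D : D \in der).

(* The extension of k_X by k_Y on which f acts as the matrix
   [[chi_Y f, D f], [0, chi_X f]]. *)
Definition ext_mod & D \in der : Type := (k * k)%type.
Local Notation E := (ext_mod der_D).

HB.instance Definition _ := GRing.Zmodule.on E.

Definition ext_scale (f : A) (v : E) : E :=
  (ev f (chi k Y) * v.1 + ev f D * v.2, ev f (chi k X) * v.2).

Let ext_scaleA f g v : ext_scale f (ext_scale g v) = ext_scale (f * g) v.
Proof.
rewrite /ext_scale /= !ev_chiM ev_derM // mulrDr mulrDl !mulrA.
by rewrite addrA.
Qed.

Let ext_scale1 : left_id 1 ext_scale.
Proof.
by case=> y x; rewrite /ext_scale /= !ev_chi1 ev_der1 // !mul1r mul0r addr0.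
Qed.

Let ext_scaleDr : right_distributive ext_scale +%R.
Proof. by move=> f u v; rewrite /ext_scale /= !mulrDr addrACA. Qed.

Let ext_scaleDl v : {morph ext_scale^~ v : f g / f + g}.
Proof. by move=> f g; rewrite /ext_scale /= !evDl !mulrDl addrACA. Qed.

HB.instance Definition _ := GRing.Zmodule_isLmodule.Build A E
  ext_scaleA ext_scale1 ext_scaleDr ext_scaleDl.

End Extension.

(** * Ext^1 computed from an arbitrary projective resolution *)

Section Resolution.
Variable P : proj_resolution (kmod k X).

(* [g] and the augmentation are the two components of a linear map from P_0 to
   the extension of k_X by k_Y given by D; [f] is the induced map P_1 -> k_Y. *)
Definition classifies (f : P 1%N -> kmod k Y) D := exists g : P 0%N -> k,
  [/\ {morph g : x y / x + y},
      forall (a : A) x, g (a *: x) = ev a (chi k Y) * g x + ev a D * res_aug P x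
    & forall y, g (res_d P 0 y) = f y].

Lemma classifies_add t f D f' D' : classifies f D -> classifies f' D' ->
  classifies (fun y => t * f y + f' y) (t *: D + D').
Proof.
case=> g [gD gZ gd] [g' [gD' gZ' gd']].
exists (fun x => t * g x + g' x); split=> [x y|a x|y]; last by rewrite gd gd'.
  by rewrite gD gD' mulrDr addrACA.
rewrite gZ gZ' evDr evZr !mulrDr !mulrDl !addrA mulrCA; congr (_ + _).
by rewrite -!addrA; congr (_ + _); rewrite addrC mulrA.
Qed.

Lemma eq_classifies f f' D : f =1 f' -> classifies f D -> classifies f' D.
Proof. by move=> ff' [g [gD gZ gd]]; exists g; split=> // y; rewrite gd. Qed.

Lemma classifies_sum n (c : 'I_n -> k) (f : 'I_n -> P 1%N -> kmod k Y) (D : 'I_n -> V) :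
  (forall i, classifies (f i) (D i)) ->
  classifies (fun y => \sum_i c i * f i y) (\sum_i c i *: D i).
Proof.
move=> fD; elim: (index_enum _) => [|i r IHr].
  exists (fun=> 0); split=> [x y|a x|y]; rewrite ?big_nil ?addr0 // mulr0 add0r.
  by rewrite /ev big1 ?mul0r // => b _; rewrite ffunE mulr0.
rewrite big_cons; apply: eq_classifies (classifies_add (c i) (fD i) IHr) => y.
by rewrite big_cons.
Qed.

Lemma aug_gen : exists u, res_aug P u = 1.
Proof. exact: res_aug_surj. Qed.

(** Let [u] have augmentation 1. Computing [g] at [ab u] directly and by acting with [b], then [a],
    gives the Leibniz rule. *)
Lemma classifies_der f D : classifies f D -> D \in der.
Proof.
case=> g [gD gZ _]; have [u u1] := aug_gen.
have gpt a (x : P 0%N) : g (pt a *: x) = chi k Y a * g x + D a * res_aug P x.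
  by rewrite gZ !ev_pt.
apply/derP => a b; have := gpt (a * b)%g u.
rewrite -ptM -scalerA !gpt linearZ /= kmodE ev_pt u1 !mulr1 chiM.
by rewrite mulrDr mulrA -addrA => /addrI.
Qed.

Lemma res_section : exists s : P 0%N -> P 1%N,
  forall x, res_aug P x = 0 -> res_d P 0 (s x) = x.
Proof.
suff /choice[s sP] : forall x, exists y, res_aug P x = 0 -> res_d P 0 y = x by exists s.
move=> x; have [/res_exact0[y yx]|x0] := pselect (res_aug P x = 0); first by exists y.
by exists 0 => /x0.
Qed.

Lemma cocycle_classifies (f : {linear P 1%N -> kmod k Y}) :
  (forall x, f (res_d P 1 x) = 0) -> exists D, classifies f D.
Proof.
move=> f0; have [u u1] := aug_gen; have [s sP] := res_section.
(* By exactness [f] factors through the image of [res_d P 0], so the non-linear choice of preimages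
   [s] does no harm. *)
have f_eq x y : res_d P 0 x = res_d P 0 y -> f x = f y.
  move=> xy; have /res_exact[z zE] : res_d P 0 (x - y) = 0 by rewrite raddfB /= xy subrr.
  by apply/eqP; rewrite -subr_eq0 -raddfB -zE; apply/eqP; exact: f0.
pose F x := f (s x).
have FD x y : res_aug P x = 0 -> res_aug P y = 0 -> F (x + y) = F x + F y.
  move=> x0 y0; rewrite -raddfD; apply: f_eq; rewrite raddfD /= !sP //.
  by rewrite raddfD /= x0 y0 addr0.
have FZ (a : A) x : res_aug P x = 0 -> F (a *: x) = a *: F x.
  move=> x0; rewrite -linearZ; apply: f_eq; rewrite linearZ /= !sP //.
  by rewrite linearZ /= x0 scaler0.
(* A k-linear projection onto the kernel of the augmentation. Its failure to be linear over the
   algebra, computed in [piZ], produces the term with D. *)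
pose pi x := x - (res_aug P x : k)%:A *: u.
have pi0 x : res_aug P (pi x) = 0.
  by rewrite raddfB /= linearZ /= scalarE u1 mulr1 subrr.
have piD x y : pi (x + y) = pi x + pi y.
  by rewrite /pi raddfD scalerDl scalerDl opprD addrACA.
have piZ (a : A) x : pi (a *: x) = a *: pi x + (res_aug P x : k)%:A *: pi (a *: u).
  rewrite /pi !scalerBr [in RHS]scaler_alg_comm addrA subrK; congr (_ - _).
  by rewrite -scaler_algl scalerA !linearZ /= !kmodE u1 mulr1 mulrC.
have piA t x : pi (t%:A *: x) = t%:A *: pi x.
  by rewrite /pi (linearZ_LR (res_aug P)) /= scalarE scalerBr -[(t * _)%:A]scalerA
    -[t%:A *: (_ *: u)]scaler_algl.
pose D : V := [ffun b => F (pi (pt b *: u))].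
have DE (a : A) : F (pi (a *: u)) = ev a D.
  rewrite {1}(balg_sum_pt a) scaler_suml.
  have piF x y : F (pi (x + y)) = F (pi x) + F (pi y) by rewrite piD FD.
  have F0 : F (pi 0) = 0.
    by apply/eqP; rewrite -(inj_eq (addrI (F (pi 0)))) -piF !addr0.
  rewrite (big_morph (fun x => F (pi x)) piF F0); apply: eq_bigr => b _.
  by rewrite scaler_algl piA FZ // scalarE ffunE.
exists D, (fun x => F (pi x)); split=> [x y|a x|y].
- by rewrite piD FD.
- rewrite piZ FD ?linearZ /= ?pi0 ?scaler0 // !FZ // kmodE scalarE DE.
  by congr (_ + _); exact: mulrC.
- apply: f_eq; rewrite sP // /pi.
  have -> : res_aug P (res_d P 0 y) = 0 by apply/res_exact0; exists y.
  by rewrite !scale0r subr0.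
Qed.

Lemma der_classifies D : D \in der ->
  exists f : {linear P 1%N -> kmod k Y},
    (forall x, f (res_d P 1 x) = 0) /\ classifies f D.
Proof.
move=> der_D.
have [|p pE] := @linear_exists _ (ext_mod der_D) (kmod k X) (fun v => v.2).
  by move=> a u v; rewrite kmodE.
have p_surj t : exists v, p v = t by exists (0, t); rewrite pE.
have [h hp] := res_projective (res_aug P) p_surj.
have h2 x : (h x).2 = res_aug P x by rewrite -hp pE.
have aug_d y : res_aug P (res_d P 0 y) = 0 by apply/res_exact0; exists y.
(* On the image of [res_d P 0] the second component of [h] vanishes, so there the first one is
   linear into k_Y. *)
have [|f fE] := @linear_exists _ (P 1%N) (kmod k Y) (fun y => (h (res_d P 0 y)).1).
  by move=> a x y; rewrite !linearP /= kmodE h2 aug_d mulr0 addr0.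
exists f; split=> [x|].
  have dd : res_d P 0 (res_d P 1 x) = 0 by apply/res_exact; exists x.
  by rewrite fE dd linear0.
exists (fun x => (h x).1); split=> [x y|a x|y].
- by rewrite raddfD.
- by rewrite linearZ /= h2.
- by rewrite fE.
Qed.

(** If D is c times the inner derivation, adding c times the augmentation to [g] makes it linear
    without changing it on boundaries. Conversely, [g] and [h] agree on the kernel of the
    augmentation, so D is determined by their difference at [u]. *)
Lemma classifies_inner (f : P 1%N -> kmod k Y) D : classifies f D ->
  (exists g : {linear P 0%N -> kmod k Y}, forall y, f y = g (res_d P 0 y)) <->
  D \in <[inner_der]>%VS.
Proof.
move=> fD; have der_D := classifies_der fD; case: fD => g [gD gZ gd].
split=> [[h hE]|/vlineP[c Dc]]; last first.
  have [|h hE] := @linear_exists _ (P 0%N) (kmod k Y) (fun x => g x + c * res_aug P x).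
    move=> a x y; rewrite gD gZ Dc evZr ev_inner_der linearP !kmodE.
    have key (p q r s t v : k) : p * q + c * (p - r) * s + t + c * (r * s + v) =
      p * (q + c * s) + (t + c * v) by ring.
    exact: key.
  exists h => y; rewrite hE gd.
  have -> : res_aug P (res_d P 0 y) = 0 by apply/res_exact0; exists y.
  by rewrite mulr0 addr0.
have [u u1] := aug_gen.
apply/vlineP; exists (h u - g u); apply/ffunP => b; rewrite !ffunE.
pose w := pt b *: u - (chi k X b)%:A *: u.
have /res_exact0[y yE] : res_aug P w = 0.
  by rewrite raddfB /= !(linearZ_LR (res_aug P)) /= u1 scalarE kmodE ev_pt subrr.
have gw : g w = h w by rewrite -yE gd hE.
have wE : pt b *: u = w + (chi k X b)%:A *: u by rewrite subrK.
have gb : chi k Y b * g u + D b = g w + chi k X b * g u.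
  have := congr1 g wE; rewrite gD !gZ !ev_pt u1 !mulr1 !evZ ev_chi1 ev_der1 //.
  by rewrite mulr0 mulr1 addr0.
have hb : chi k Y b * h u = h w + chi k X b * h u.
  by have := congr1 h wE; rewrite linearD !linearZ_LR scalarE kmodE ev_pt.
have key (p q r s t v : k) : p * q + r = s + t * q -> p * v = s + t * v ->
    r = (v - q) * (p - t).
  move=> E1 E2; have -> : r = p * q + r - p * q by ring.
  rewrite E1; have -> : s = s + t * v - t * v by ring.
  rewrite -E2; ring.
by apply: key hb; rewrite gb gw.
Qed.

(** The family [z] consists of cocycles for a basis of a complement [W] of the inner line in
    [der]. *)
Lemma ext1_dim_res :
  exists z : 'I_(\dim (der :\: <[inner_der]>)) -> {linear P 1%N -> kmod k Y},
    (forall i x, z i (res_d P 1 x) = 0) /\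
    (forall f : {linear P 1%N -> kmod k Y}, (forall x, f (res_d P 1 x) = 0) ->
       exists! c : 'rV[k]_(\dim (der :\: <[inner_der]>)),
         exists g : {linear P 0%N -> kmod k Y},
         forall x, f x = \sum_i (c 0 i)%:A *: z i x + g (res_d P 0 x)).
Proof.
set W := (der :\: _)%VS; pose bs := vbasis W.
have Wbs (i : 'I_(\dim W)) : bs`_i \in W.
  by apply/vbasis_mem/mem_nth; rewrite size_tuple.
have bsder (i : 'I_(\dim W)) : bs`_i \in der.
  exact: (subvP (diffvSl der <[inner_der]>)) (Wbs i).
have /fin_all_exists[z zP] i := der_classifies (bsder i).
exists z; split=> [i|f f0]; first by case: (zP i).
have [D fD] := cocycle_classifies f0.
(* This turns the condition on [c] into linear algebra modulo the inner line: D splits along [W] for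
   existence, and [W] meets the line in 0 for uniqueness. *)
have cP (c : 'rV[k]_(\dim W)) :
    (exists g : {linear P 0%N -> kmod k Y},
      forall x, f x = \sum_i (c 0 i)%:A *: z i x + g (res_d P 0 x)) <->
    D - \sum_i c 0 i *: bs`_i \in <[inner_der]>%VS.
  have := classifies_sum (c 0) (fun i => (zP i).2).
  move=> /(classifies_add (-1))/(_ fD); rewrite scaleN1r addrC => /classifies_inner <-.
  have zE x : \sum_i (c 0 i)%:A *: z i x = \sum_i c 0 i * z i x.
    by apply: eq_bigr => i _; rewrite scalarE.
  split=> -[g gE]; exists g => x.
    by rewrite gE zE mulN1r addKr.
  by rewrite -gE zE mulN1r addNKr.
have /memv_addP[w Ww [d]] : D \in (W + (der :&: <[inner_der]>))%VS.
  by rewrite addv_diff_cap (classifies_der fD).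
rewrite memv_cap => /andP[_ d_inner] DE.
exists (\row_i coord bs i w); split.
  apply/cP; under eq_bigr => i _ do rewrite mxE.
  by rewrite -(coord_vbasis Ww) DE addrC addKr.
move=> c /cP c_inner; apply/rowP => j; rewrite mxE.
set v := \sum_i c 0 i *: bs`_i in c_inner.
have Wv : v \in W.
  by apply: memv_suml => i _; apply: memvZ; apply: Wbs.
have : w - v \in (W :&: <[inner_der]>)%VS.
  rewrite memv_cap rpredB //=.
  have -> : w - v = D - v - d by rewrite DE addrAC addrK.
  by rewrite rpredB.
rewrite capv_diff memv0 subr_eq0 => /eqP->.
by rewrite coord_sum_free // (basis_free (vbasisP W)).
Qed.

End Resolution.

Lemma ext1_dim_kmod :
  ext1_dim (kmod k X) (kmod k Y) (\dim (der :\: <[inner_der]>)).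
Proof. by move=> P; apply: ext1_dim_res. Qed.

End Derivations.

(** * Locally constant functions and connected components *)

Section Components.
Variables (T : finType) (k : fieldType) (le : rel T) (P : {set T}).
Hypothesis le_refl : reflexive le.
Local Notation V := {ffun T -> k^o}.
Local Notation K := (order_complex le P).

Lemma order_complex_vertex x : ([set x] \in K) = (x \in P).
Proof.
rewrite inE -card_gt0 cards1 sub1set /=; case: (x \in P) => //=.
apply/'forall_implyP => y /set1P->; apply/'forall_implyP => z /set1P->.
by rewrite le_refl.
Qed.

Lemma order_complex_edge x y :
  [set x; y] \in K = [&& x \in P, y \in P & le x y || le y x].
Proof.
rewrite inE subUset !sub1set -andbA; have -> /= : [set x; y] != set0.
  by apply/set0Pn; exists x; rewrite set21.
congr [&& _, _ & _]; apply/'forall_implyP/idP => [/(_ x (set21 _ _))|xy z].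
  by move/'forall_implyP; apply; rewrite set22.
by rewrite !inE => /orP[] /eqP->; apply/'forall_implyP => t; rewrite !inE;
  move=> /orP[] /eqP->; rewrite ?le_refl // orbC.
Qed.

(** Evaluation at one root per component maps U isomorphically onto all functions on the roots: the
    first two hypotheses give injectivity, the third surjectivity. *)
Lemma dim_locally_constant (U : {vspace V}) :
    (forall D, D \in U -> {in P &, forall x y, le x y -> D x = D y}) ->
    (forall D, D \in U -> {in P, forall x, D x = 0} -> D = 0) ->
    (forall F : T -> k, {in P &, forall x y, le x y -> F x = F y} ->
      exists2 D, D \in U & {in P, D =1 F}) ->
  \dim U = n_components K.
Proof.
move=> Uconst Uinj Uext.
pose r : rel T := [rel x y | [set x; y] \in K].
have rE x y : r x y = [&& x \in P, y \in P & le x y || le y x].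
  exact: order_complex_edge.
have rC : connect_sym r by apply: sym_connect_sym => x y; rewrite /r /= setUC.
have r_root x : x \in P -> fingraph.root r x \in P.
  move=> xP; have cl : closed r (mem P).
    by apply: intro_closed => // u v; rewrite rE => /and3P[].
  by rewrite -(closed_connect cl (connect_root r x)).
have r_const (F : T -> k) x : {in P &, forall x y, le x y -> F x = F y} ->
    F x = F (fingraph.root r x).
  move=> Fc; have /connectP[p] := connect_root r x; move: (fingraph.root r x) => y.
  elim: p x => [|z p IH] x /=; first by move=> _ ->.
  rewrite rE => /andP[/and3P[xP zP xz] pz] yE; rewrite -(IH z) //.
  by case/orP: xz => [/Fc->//|/Fc <-].
(* By definition [n_components K] counts these roots. *)
pose I : finType := {z : T | (z \in predI (roots r) [pred x | [set x] \in K])}.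
pose phi (D : V) : {ffun I -> k^o} := [ffun z => D (val z)].
have phi_lin : linear phi by move=> t D D'; apply/ffunP => z; rewrite !ffunE.
have [Phi PhiE] := @linear_exists _ V {ffun I -> k^o} _ phi_lin.
have -> : n_components K = #|I| by rewrite card_sig.
rewrite -(@limg_dim_eq _ _ _ (linfun Phi)); last first.
  apply/eqP; rewrite -subv0; apply/subvP => D.
  rewrite memv_cap memv_ker lfunE /= PhiE => /andP[DU /eqP D0].
  rewrite memv0; apply/eqP/Uinj => // x xP.
  rewrite (r_const _ _ (Uconst D DU)).
  have rI : fingraph.root r x \in predI (roots r) [pred x | [set x] \in K].
    by apply/andP; split; [exact: roots_root | rewrite inE /= order_complex_vertex r_root].
  have := congr1 (fun G : {ffun I -> k^o} => G (Sub (fingraph.root r x) rI)) D0.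
  by rewrite !ffunE.
suff -> : (linfun Phi @: U)%VS = fullv by rewrite dimvf /dim /= muln1.
apply/eqP; rewrite eqEsubv subvf /=; apply/subvP => G _.
(* The value of [G] at the root of the component of [x]; the default 0 is only taken outside P. *)
pose F x := if insub (fingraph.root r x) is Some z then (G : {ffun I -> k}) z else 0.
have [x y xP yP xy|D DU DF] := Uext F.
  congr (if insub _ is Some z then G z else 0); apply/(fingraph.rootP rC).
  by apply: connect1; rewrite rE xP yP xy.
apply/memv_imgP; exists D => //; apply/ffunP => z.
rewrite lfunE /= PhiE ffunE; have /andP[z_root zK] := valP z.
rewrite DF; last by move: zK; rewrite inE /= order_complex_vertex.
by rewrite /F (eqP z_root) valK.
Qed.

End Components.

(** * The dimension of the space of derivations *)

Section Dimension.
Variables (B : clrbType) (k : fieldType) (X Y : Lam B).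
Local Notation V := {ffun B -> k^o}.
Local Notation der := (der k X Y).
Local Notation inner_der := (inner_der k X Y).

(** Apply the Leibniz rule to bb = b: equal characters at b give D(b) = 2 D(b) or D(b) = 0. *)
Lemma der_diag D b : D \in der -> D b != 0 -> (b \in upset X) != (b \in upset Y).
Proof.
move=> /derP/(_ b b); rewrite bandxx /chi => Db; apply: contra => /eqP XY.
move: Db; rewrite XY; case: (b \in upset Y); rewrite ?mul1r ?mulr1 ?mul0r ?mulr0 ?addr0.
  by move/eqP; rewrite -subr_eq0 opprD addrA subrr sub0r oppr_eq0.
by move->.
Qed.

Lemma der_inner D : ~~ Lam_lt X Y -> D \in der -> D \in <[inner_der]>%VS.
Proof.
move=> XY der_D; have /derP DM := der_D.
have [y yY] := Lam_repr Y; have Vy : y \in upset Y by rewrite (upset_sub _ yY).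
have D0 b : (b \in upset X) = (b \in upset Y) -> D b = 0.
  by move=> b_eq; apply/eqP/negPn/negP => /(der_diag der_D); rewrite b_eq eqxx.
have [XsubY|] := boolP (X \subset Y).
  have EXY : X = Y.
    apply/val_inj/eqP; rewrite eqEsubset XsubY /=.
    by move: XY; rewrite /Lam_lt properE XsubY negbK.
  have -> : D = 0 by apply/ffunP => b; rewrite ffunE D0 // EXY.
  exact: mem0v.
rewrite -(upset_sub _ yY) => Uy; apply/vlineP; exists (D y).
have cXy : chi k X y = 0 by rewrite /chi (negPf Uy).
have cYy : chi k Y y = 1 by rewrite /chi Vy.
(* Leibniz for (yb)y = yb, where [chi X y] is 0; expanding D(yb) as a product of y and b then
   isolates D(b). *)
have Dyb b : D (y * b)%g = chi k Y b * D y.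
  by rewrite -bandxyx DM chiM cXy cYy mulr0 addr0 mul1r.
apply/ffunP => b; rewrite !ffunE.
have := Dyb b; rewrite DM cYy mul1r => Db.
have -> : D b = chi k Y b * D y - D y * chi k X b by rewrite -Db addrK.
by rewrite [RHS]mulrBr; congr (_ - _); exact: mulrC.
Qed.

Lemma ext_dim_not_lt : ~~ Lam_lt X Y -> \dim (der :\: <[inner_der]>) = 0%N.
Proof.
move=> XY; apply/eqP; rewrite dimv_eq0 diffv_eq0.
by apply/subvP => D; apply: der_inner.
Qed.

(** An element c with ec = c differs from e exactly when c is outside B_{>=Y}, since membership
    there means ec = e. *)
Lemma mem_partial_upset (e c : B) : Lam_lt X Y -> lideal e = Y ->
  (c \in partial_upset e X) = [&& (e * c)%g == c, c \in upset X & c \notin upset Y].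
Proof.
move=> /proper_sub XY eY.
have eX : e \in upset X by rewrite (upset_sub _ eY).
rewrite /partial_upset in_setD1 (mem_upset _ eY); apply/andP/and3P.
  case=> ce /imsetP[b bX cE]; have ec : (e * c = c)%g by rewrite cE mulgA bandxx.
  by rewrite ec eqxx ce cE upsetM eX bX.
case=> /eqP ec cX; rewrite ec => ce; split=> //.
by apply/imsetP; exists c.
Qed.

Lemma dim_der (e : B) : Lam_lt X Y -> lideal e = Y ->
  \dim der = n_components (order_complex (@band_le B) (partial_upset e X)).
Proof.
move=> XY eY; have memP c := mem_partial_upset c XY eY.
have UV b : b \in upset Y -> b \in upset X.
  by rewrite !inE; apply: subset_trans; apply: proper_sub.
have Ye : e \in upset Y by rewrite (mem_upset _ eY) bandxx.
apply: dim_locally_constant => [b|D /derP DM|D der_D DP|F Fc].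
- by rewrite /band_le bandxx.
- move=> a c; rewrite !memP => /and3P[_ aX _] /and3P[_ _ cY] /eqP ca.
  (* Here a = ca, and Leibniz reduces D(ca) to D(c). *)
  by rewrite -{1}ca DM /chi aX (negPf cY) mul0r add0r mulr1.
- have D0 b : (b \in upset X) = (b \in upset Y) -> D b = 0.
    by move=> b_eq; apply/eqP/negPn/negP => /(der_diag der_D); rewrite b_eq eqxx.
  have /derP DM := der_D; apply/ffunP => b; rewrite ffunE.
  have [bY|bY] := boolP (b \in upset Y); first by rewrite D0 // bY UV.
  have [bX|bX] := boolP (b \in upset X); last by rewrite D0 // (negPf bX) (negPf bY).
  (* D(e) = 0, so D(b) is already seen at eb, which lies in the boundary. *)
  have : D (e * b)%g = D b.
    by rewrite DM [D e]D0 ?UV // mul0r addr0 /chi Ye mul1r.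
  by move <-; apply: DP; rewrite memP mulgA bandxx eqxx !upsetM Ye UV ?bX.
(* The only possible extension, by D(b) = D(eb). *)
pose D : V := [ffun b => if (b \in upset X) && (b \notin upset Y) then F (e * b)%g else 0].
exists D; last first.
  by move=> c; rewrite memP ffunE => /and3P[/eqP-> -> ->].
apply/derP => a b; rewrite !ffunE !upsetM /chi.
have [bX|bX] := boolP (b \in upset X); rewrite ?andbF ?andbT /= ?mulr1 ?mulr0 ?addr0 //.
have [aX|aX] := boolP (a \in upset X); last first.
  by rewrite (negPf (contra (@UV a) aX)) mul0r add0r.
(* If a is in B_{>=Y}, then ea = e and so eab = eb; otherwise eab lies below ea in the boundary and
   F agrees on the two. *)
have [aY|aY] /= := boolP (a \in upset Y).
  rewrite mul1r addr0; case: ifP => // _; congr F; rewrite mulgA.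
  by have := aY; rewrite (mem_upset _ eY) => /eqP->.
rewrite mul0r add0r; apply: Fc; rewrite ?memP ?mulgA ?bandxx ?eqxx ?upsetM ?aX ?bX
  ?(UV e) ?Ye ?(negPf aY) //.
by rewrite /band_le mulgA bandxx.
Qed.

Lemma ext_dim_lt (e : B) : Lam_lt X Y -> lideal e = Y ->
  (\dim (der :\: <[inner_der]>)).+1 =
    n_components (order_complex (@band_le B) (partial_upset e X)).
Proof.
move=> XY eY; rewrite -(dim_der XY eY) -(dimv_cap_compl der <[inner_der]>).
rewrite (capv_idPr _) -?memvE ?inner_der_der // dim_vline.
(* The inner line accounts for the one fewer: its generator is -1 at any x with Bx = X. *)
suff -> : inner_der != 0 by [].
have [x xX] := Lam_repr X.
apply/eqP => /ffunP/(_ x); rewrite !ffunE /chi !(upset_sub _ xX) subxx.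
move: XY; rewrite /Lam_lt properE => /andP[_ /negPf->].
by move/eqP; rewrite sub0r oppr_eq0 oner_eq0.
Qed.

End Dimension.

Theorem theorem5p18 (B : clrbType) (k : fieldType) :
  exists arrows : Lam B -> Lam B -> nat,
    [/\ is_gabriel_quiver (fun X : Lam B => kmod k X : lmodType (balg k B)) arrows,
        forall X Y : Lam B, ~~ Lam_lt X Y -> arrows X Y = 0%N
      & forall (X Y : Lam B) (eY : B), Lam_lt X Y -> lideal eY = Y ->
          (arrows X Y).+1 =
            n_components (order_complex (@band_le B) (partial_upset eY X))].
Proof.
exists (fun X Y => \dim (der k X Y :\: <[inner_der k X Y]>)); split.
- split=> [X|M|X Y|X Y].
  + exact: kmod_simple.
  + exact: simple_kmod.
  + exact: kmod_iso_inj.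
  + exact: ext1_dim_kmod.
- exact: ext_dim_not_lt.
- by move=> X Y e XY eY; apply: ext_dim_lt.
Qed.
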